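(* Let $(S,s)$ be a commutative non-degenerate solution and let $(S,\cdot)$ be its underlying semigroup. Then $(S,\cdot)$ is weak commutative, and there exist a congruence $\sim$ of $(S,\cdot)$ such that $S/\!\sim$ is a left-zero semigroup, a subgroup $\mathcal{G}$ of $\mathrm{Aut}(S,\cdot)$ acting semi-regularly on $S$, and a $\sim$-class $T$, such that: every $\mathcal{G}$-orbit is a set of representatives of $S/\!\sim$; the partition of $S$ into $\sim$-classes is a system of blocks of $\mathcal{G}$; and $s(x,y)=(x\cdot y,\theta_x(y))$ for all $x,y\in S$, where $\theta:S\to\mathcal{G}$ is the map given by $\theta_{t}=\mathrm{id}_S$ and $\theta_{g(t)}=g^{-1}$ for all $t\in T$ and $g\in\mathcal{G}$.
   Context: A solution (set-theoretic solution of the Pentagon Equation) is a pair $(S,s)$ with $S$ a non-empty set and $s:S\times S\to S\times S$ a map such that $s_{23}s_{13}s_{12}=s_{12}s_{23}$ as maps $S^3\to S^3$, where $s_{12}=s\times \mathrm{id}$, $s_{23}=\mathrm{id}\times s$, $s_{13}=(\tau\times \mathrm{id})(\mathrm{id}\times s)(\tau\times \mathrm{id})$ and $\tau(x,y)=(y,x)$. Writing $s(x,y)=(x\cdot y,\theta_x(y))$, the pair $(S,s)$ is a solution if and only if for all $x,y,z\in S$: $(x\cdot y)\cdot z=x\cdot(y\cdot z)$, $\theta_x(y)\cdot\theta_{x\cdot y}(z)=\theta_x(y\cdot z)$, and $\theta_{\theta_x(y)}\theta_{x\cdot y}=\theta_y$; $(S,\cdot)$ is called its underlying semigroup. It is commutative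 if $s_{12}s_{13}=s_{13}s_{12}$, equivalently $x\cdot y\cdot z=x\cdot z\cdot y$ and $\theta_{x\cdot y}=\theta_x$ for all $x,y,z\in S$. It is non-degenerate if every $\theta_x:S\to S$ is bijective. A semigroup is weak commutative if $x\cdot y\cdot z=x\cdot z\cdot y$ for all $x,y,z$; it is left-zero if $x\cdot y=x$ for all $x,y$. A permutation group on $S$ is semi-regular if every point of $S$ has trivial stabilizer. If a group $G$ acts on $S$, a subset $B\subseteq S$ is a block if for each $g\in G$ the set $g(B)$ either equals $B$ or is disjoint from $B$; a partition of $S$ is a system of blocks if each of its members is a block. ''Set of representatives of $S/\!\sim$'' means a subset containing exactly one element of each $\sim$-class. *)

(* Defs.v *)
From mathcomp Require Import all_boot.
From mathcomp Require Import boolp classical_sets.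

Set Implicit Arguments.
Unset Strict Implicit.
Unset Printing Implicit Defensive.

Local Open Scope classical_set_scope.

Section Pentagon.
Variables (S : Type) (s : S * S -> S * S).

(* Triples are left-nested: [S * S * S] is [(S * S) * S]. *)
Definition s12 (p : S * S * S) : S * S * S :=
  let: (x, y, z) := p in let: (x', y') := s (x, y) in (x', y', z).

Definition s23 (p : S * S * S) : S * S * S :=
  let: (x, y, z) := p in let: (y', z') := s (y, z) in (x, y', z').

Definition tau12 (p : S * S * S) : S * S * S :=
  let: (x, y, z) := p in (y, x, z).

Definition s13 : S * S * S -> S * S * S := tau12 \o s23 \o tau12.

Definition pentagon_solution : Prop :=
  [set: S] !=set0 /\ s23 \o s13 \o s12 =1 s12 \o s23.

Definition commutative_solution : Prop := s12 \o s13 =1 s13 \o s12.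

Definition sol_mul (x y : S) : S := (s (x, y)).1.
Definition sol_theta (x y : S) : S := (s (x, y)).2.

Definition nondegenerate : Prop := forall x, bijective (sol_theta x).

End Pentagon.

Section Semigroups.
Variables (X : Type) (D : set X) (mul : X -> X -> X).

(* Semigroups are given by a carrier [D] inside an ambient type, so that the
   quotient by a congruence can be carried by its set of classes. *)
Definition semigroup : Prop :=
  (forall x y, D x -> D y -> D (mul x y)) /\
  (forall x y z, D x -> D y -> D z -> mul (mul x y) z = mul x (mul y z)).

Definition weak_commutative : Prop :=
  semigroup /\
  (forall x y z, D x -> D y -> D z -> mul (mul x y) z = mul (mul x z) y).

Definition left_zero_semigroup : Prop :=
  semigroup /\ (forall x y, D x -> D y -> mul x y = x).

End Semigroups.

Section Congruences.
Variables (S : Type) (mul : S -> S -> S) (sim : S -> S -> Prop).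

Definition congruence : Prop :=
  RelationClasses.Equivalence sim /\
  (forall x x' y y', sim x x' -> sim y y' -> sim (mul x y) (mul x' y')).

Definition sim_classes : set (set S) := [set A | exists x, A = [set y | sim x y]].

(* Product of the quotient: for a congruence this is the class of [mul a b]
   for any [a] in [A] and [b] in [B]. *)
Definition class_mul (A B : set S) : set S :=
  [set z | exists a b, [/\ A a, B b & sim (mul a b) z]].

Definition set_of_representatives (B : set S) : Prop :=
  forall A, sim_classes A -> exists! x, (A `&` B) x.

End Congruences.

Section Actions.
Variable S : Type.
Implicit Types (mul : S -> S -> S) (G : set (S -> S)) (B T : set S).

Definition semigroup_Aut mul : set (S -> S) :=
  [set f | bijective f /\ {morph f : x y / mul x y}].

Definition is_inverse (g h : S -> S) : Prop := cancel g h /\ cancel h g.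

(* Subgroups of the automorphism group, as sets of maps under composition. *)
Definition subgroup_of_Aut mul G : Prop :=
  [/\ G `<=` semigroup_Aut mul,
      G id,
      forall g h, G g -> G h -> G (g \o h)
    & forall g, G g -> exists2 h, G h & is_inverse g h].

Definition semi_regular G : Prop := forall x g, G g -> g x = x -> g = id.

Definition orbit_of G (x : S) : set S := [set g x | g in G].

Definition block G B : Prop :=
  forall g, G g -> g @` B = B \/ g @` B `&` B = set0.

Definition system_of_blocks G (P : set (set S)) : Prop :=
  partition P id [set: S] /\ (forall B, P B -> block G B).

(* The conditions prescribing [theta : S -> G]: [theta_t = id] and
   [theta_(g t) = g^-1] for [t] in [T] and [g] in [G]. *)
Definition theta_prescribed G T (theta : S -> S -> S) : Prop :=
  [/\ forall x, G (theta x),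
      forall t, T t -> theta t = id
    & forall t g, T t -> G g -> is_inverse g (theta (g t))].

End Actions.

(* Main.v *)
Require Import Defs.
From mathcomp Require Import all_boot boolp classical_sets.

Set Implicit Arguments.
Unset Strict Implicit.
Unset Printing Implicit Defensive.

Local Open Scope classical_set_scope.

(** Write s (x, y) = (x . y, theta_x y).  Commutativity gives theta_(x . y) =
    theta_x, and this collapses the last two pentagon identities to the
    statements that each theta_x is an endomorphism and that
      theta_(theta_x y) o theta_x = theta_y     (lemma [sol_theta_theta]).
    When the theta_x are bijective the latter reads
    theta_(g y) = theta_y o g^-1 for every g of the form theta_x: acting by g on
    the index multiplies theta on the right by g^-1.  Everything follows from
    this equivariance.  Let G be the set of all theta_x, let x ~ y mean
    theta_x = theta_y, and let T be the set of those t with theta_t = id.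
    - Taking y = x gives theta_(theta_x x) = id, so T is not empty and G contains
      id; taking y in T gives inverses, and then a general y gives products.
    - If g fixes x then theta_x = theta_x o g^-1, so g = id: the action is
      semi-regular.
    - The point g x is in the class of y exactly when g = theta_y^-1 o theta_x,
      so an orbit meets each class exactly once.
    - Equivariance also says that g permutes the classes, which are therefore
      blocks.
    - On T it says that theta_(g t) = g^-1, and since every orbit meets T this
      determines theta.
    The quotient by ~ is left-zero because theta_(x . y) = theta_x. *)

(** * The component identities of a commutative solution *)

Section Components.
Variables (S : Type) (s : S * S -> S * S).

Lemma sol_pairE x y : s (x, y) = (sol_mul s x y, sol_theta s x y).
Proof. by rewrite /sol_mul /sol_theta; case: (s _). Qed.

Lemma s12E x y z : s12 s (x, y, z) = (sol_mul s x y, sol_theta s x y, z).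
Proof. by rewrite /s12 sol_pairE. Qed.

Lemma s23E x y z : s23 s (x, y, z) = (x, sol_mul s y z, sol_theta s y z).
Proof. by rewrite /s23 sol_pairE. Qed.

Lemma s13E x y z : s13 s (x, y, z) = (sol_mul s x z, y, sol_theta s x z).
Proof. by rewrite /s13 /= sol_pairE. Qed.

Lemma pentagon_solutionP : pentagon_solution s -> forall x y z,
  [/\ sol_mul s (sol_mul s x y) z = sol_mul s x (sol_mul s y z),
      sol_mul s (sol_theta s x y) (sol_theta s (sol_mul s x y) z) =
        sol_theta s x (sol_mul s y z)
    & sol_theta s (sol_theta s x y) (sol_theta s (sol_mul s x y) z) =
        sol_theta s y z].
Proof.
move=> [_ pent] x y z; have := pent (x, y, z).
by rewrite /comp s12E s13E !s23E s12E => -[].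
Qed.

Lemma commutative_solutionP : commutative_solution s ->
  (forall x y z,
    sol_mul s (sol_mul s x y) z = sol_mul s (sol_mul s x z) y) /\
  (forall x y, sol_theta s (sol_mul s x y) = sol_theta s x).
Proof.
move=> comm; suff E x y z :
    sol_mul s (sol_mul s x y) z = sol_mul s (sol_mul s x z) y /\
    sol_theta s (sol_mul s x y) z = sol_theta s x z.
  by split=> [x y z | x y]; [| apply/funext => z]; case: (E x y z).
have := comm (x, y, z).
by rewrite /comp s13E !s12E s13E => -[-> _ ->].
Qed.

Hypotheses (s_sol : pentagon_solution s) (s_comm : commutative_solution s).

Lemma sol_mulAC x y z :
  sol_mul s (sol_mul s x y) z = sol_mul s (sol_mul s x z) y.
Proof. exact: (commutative_solutionP s_comm).1. Qed.

Lemma sol_theta_mull x y : sol_theta s (sol_mul s x y) = sol_theta s x.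
Proof. exact: (commutative_solutionP s_comm).2. Qed.

Lemma sol_theta_morph x : {morph sol_theta s x : y z / sol_mul s y z}.
Proof.
move=> y z; have [_ <- _] := pentagon_solutionP s_sol x y z.
by rewrite sol_theta_mull.
Qed.

Lemma sol_theta_theta x y :
  sol_theta s (sol_theta s x y) \o sol_theta s x = sol_theta s y.
Proof.
apply/funext => z /=.
by have [_ _] := pentagon_solutionP s_sol x y z; rewrite sol_theta_mull.
Qed.

End Components.

(** * The group of the maps theta and the fibres of theta *)

Section Equivariance.
Variables (S : Type) (theta : S -> S -> S).
Hypothesis theta_bij : forall x, bijective (theta x).
Hypothesis theta_theta : forall x y, theta (theta x y) \o theta x = theta y.

Definition theta_maps : set (S -> S) := range theta.
Definition same_theta (x y : S) : Prop := theta x = theta y.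
Definition theta_kernel : set S := [set t | theta t = id].

(** The equivariance theta_(g y) = theta_y o g^-1, with g moved to the left so
    that no inverse has to be named. *)
Lemma theta_act g y : theta_maps g -> theta (g y) \o g = theta y.
Proof. by move=> [x _ <-]. Qed.

Lemma theta_maps_bij g : theta_maps g -> bijective g.
Proof. by move=> [x _ <-]. Qed.

Lemma theta_maps_epi g (u v : S -> S) :
  theta_maps g -> u \o g = v \o g -> u = v.
Proof.
move=> /theta_maps_bij [h _ hK] E; apply/funext => x.
by rewrite -[x]hK; exact: (congr1 (fun f => f (h x)) E).
Qed.

(** This holds because acting by theta_x on the index x itself multiplies theta_x
    by its own inverse. *)
Lemma theta_kernel_self x : theta_kernel (theta x x).
Proof.
by apply: (@theta_maps_epi (theta x)); [exists x | rewrite theta_theta].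
Qed.

Lemma theta_act_kernel g t :
  theta_maps g -> theta_kernel t -> is_inverse g (theta (g t)).
Proof.
move=> Gg Tt; have gK : cancel g (theta (g t)).
  by move=> z; rewrite -[RHS]/(id z) -Tt -(theta_act t Gg).
by split=> //; exact/(bij_can_sym (theta_maps_bij Gg)).
Qed.

Lemma theta_maps_id : S -> theta_maps id.
Proof. by move=> x; exists (theta x x) => //; exact: theta_kernel_self. Qed.

Lemma theta_maps_inv g :
  theta_maps g -> exists2 h, theta_maps h & is_inverse g h.
Proof.
move=> Gg; have [x _ _] := Gg.
exists (theta (g (theta x x))); first by exists (g (theta x x)).
by apply: theta_act_kernel => //; exact: theta_kernel_self.
Qed.

Lemma theta_maps_comp g h :
  theta_maps g -> theta_maps h -> theta_maps (g \o h).
Proof.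
move=> [y _ <-] Gh; have [k Gk [hK kK]] := theta_maps_inv Gh.
(* theta_(k y) = theta_y o k^-1, and k^-1 is h *)
exists (k y) => //; apply: (theta_maps_epi Gk); rewrite theta_act //.
by apply/funext => z /=; rewrite kK.
Qed.

Lemma theta_maps_semi_regular : semi_regular theta_maps.
Proof.
move=> x g Gg gx; have := theta_act x Gg; rewrite gx => E.
have [h hK _] := theta_bij x; apply/funext => z.
by rewrite -[LHS]hK -[RHS]hK; congr h; exact: (congr1 (fun f => f z) E).
Qed.

Lemma same_theta_act g x y :
  theta_maps g -> same_theta (g x) (g y) <-> same_theta x y.
Proof.
move=> Gg; rewrite /same_theta; split=> E.
  by rewrite -(theta_act x Gg) E theta_act.
by apply: (theta_maps_epi Gg); rewrite !theta_act.
Qed.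

Lemma same_theta_equiv : RelationClasses.Equivalence same_theta.
Proof. by rewrite /same_theta; split=> [x | x y | x y z ->]. Qed.

Lemma theta_kernel_class : S -> sim_classes same_theta theta_kernel.
Proof.
move=> x; have Tx : theta (theta x x) = id := theta_kernel_self x.
exists (theta x x).
by apply/seteqP; split=> y; rewrite /same_theta /theta_kernel /= Tx => ->.
Qed.

Lemma orbit_representatives x :
  set_of_representatives same_theta (orbit_of theta_maps x).
Proof.
move=> _ [y ->]; have Gx : theta_maps (theta x) by exists x.
have [h Gh [yK hK]] : exists2 h, theta_maps h & is_inverse (theta y) h.
  by apply: theta_maps_inv; exists y.
(* g x lies in the class of y when theta_y o g = theta_x *)
have theta_hx : theta y \o (h \o theta x) = theta x.
  by apply/funext => z /=; rewrite hK.
have Ghx := theta_maps_comp Gh Gx.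
exists ((h \o theta x) x); split.
  split; last by exists (h \o theta x).
  by apply: (theta_maps_epi Ghx); rewrite theta_act.
move=> _ [/[swap] -[g Gg <-] yg].
by rewrite /= -(theta_act x Gg) -yg /= yK.
Qed.

Lemma same_theta_blocks : system_of_blocks theta_maps (sim_classes same_theta).
Proof.
split=> [|_ [x ->] g Gg].
  split.
  - apply/seteqP; split=> // x _.
    by exists [set y | same_theta x y]; first by exists x.
  - move=> _ _ [x ->] [y ->] [z [/= xz yz]].
    by apply/seteqP; split=> w /=; rewrite /same_theta xz yz.
  - by move=> _ [x ->]; exists x.
have [h Gh [gK hK]] := theta_maps_inv Gg.
have [xgx|xgx] := pselect (same_theta x (g x)); [left|right].
  apply/seteqP; split=> [_ [y xy <-] | y xy] /=.
    by rewrite /same_theta xgx; apply/same_theta_act.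
  exists (h y) => //=; apply/(@same_theta_act g) => //; rewrite hK.
  by rewrite /same_theta -xgx.
rewrite -subset0 => _ [[y xy <-] /= xgy]; apply: xgx.
by rewrite /same_theta xgy; apply/same_theta_act.
Qed.

Lemma theta_prescribed_unique :
  unique (theta_prescribed theta_maps theta_kernel) theta.
Proof.
split=> [|theta' [_ _ theta'_inv]].
  by split=> [x | t // | t g Tt Gg]; [exists x | exact: theta_act_kernel].
apply/funext => x.
have [h Gh [xK hK]] : exists2 h, theta_maps h & is_inverse (theta x) h.
  by apply: theta_maps_inv; exists x.
(* x = h t with t = theta_x x in T, so theta_x and theta'_x both invert h *)
have [_ h'K] := theta'_inv _ _ (theta_kernel_self x) Gh.
apply/funext => z; rewrite -{1}[z]h'K xK.
exact: hK.
Qed.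

End Equivariance.

(** * The decomposition of a commutative non-degenerate solution *)

Theorem corollary14 (S : Type) (s : S * S -> S * S)
    (s_sol : pentagon_solution s)
    (s_comm : commutative_solution s)
    (s_nondeg : nondegenerate s) :
  weak_commutative [set: S] (sol_mul s) /\
  exists (sim : S -> S -> Prop) (G : set (S -> S)) (T : set S),
    congruence (sol_mul s) sim /\
    left_zero_semigroup (sim_classes sim) (class_mul (sol_mul s) sim) /\
    subgroup_of_Aut (sol_mul s) G /\
    semi_regular G /\
    sim_classes sim T /\
    (forall x, set_of_representatives sim (orbit_of G x)) /\
    system_of_blocks G (sim_classes sim) /\
    exists theta : S -> S -> S,
      unique (theta_prescribed G T) theta /\
      forall x y, s (x, y) = (sol_mul s x y, theta x y).
Proof.
have [[x0 _] _] := s_sol.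
have theta_theta := sol_theta_theta s_sol s_comm.
have theta_mull := sol_theta_mull s_comm.
split.
  split; last by move=> *; exact: sol_mulAC.
  by split=> // x y z _ _ _; case: (pentagon_solutionP s_sol x y z).
pose sim := same_theta (sol_theta s).
have class_mulE A B : sim_classes sim A -> sim_classes sim B ->
    class_mul (sol_mul s) sim A B = A.
  move=> [x ->] [y ->]; apply/seteqP; split=> z /=.
    move=> [a [b [/= xa _ abz]]].
    by rewrite /sim /same_theta xa -(theta_mull a b).
  move=> xz; exists x, y; split=> //.
  by rewrite /sim /same_theta theta_mull.
exists sim, (theta_maps (sol_theta s)), (theta_kernel (sol_theta s)).
split.
  split; first exact: same_theta_equiv.
  by move=> x x' y y' xx' _; rewrite /sim /same_theta !theta_mull.
split.
  split; last exact: class_mulE.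
  by split=> [A B CA CB | A B C CA CB CC]; rewrite !class_mulE.
split.
  split.
  - by move=> _ [x _ <-]; split; [exact: s_nondeg | exact: sol_theta_morph].
  - exact: theta_maps_id.
  - exact: theta_maps_comp.
  - exact: theta_maps_inv.
split; first exact: theta_maps_semi_regular.
split; first exact: theta_kernel_class.
split; first exact: orbit_representatives.
split; first exact: same_theta_blocks.
exists (sol_theta s); split; first exact: theta_prescribed_unique.
exact: sol_pairE.
Qed.
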